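(* Assume that $d\ge1$ and $2+\frac4d<p+1<2^{*}$. Then $$N_1^{\frac{p-1}2}=\Big(\frac2d\Big)^{\frac{p-1}2}\Big\{\frac{d(p-1)}{(d+2)-(d-2)p}\Big\}^{\frac14\{(d+2)-(d-2)p\}}N_2$$ and $$N_3=\frac{d(p-1)}{2(p+1)}\,N_2 .$$
   Context: $2^{*}=\infty$ if $d=1,2$ and $2^{*}=\frac{2d}{d-2}$ if $d\ge3$. For complex-valued $f\in H^1(\mathbb{R}^d)$ let $$\mathcal{K}(f)=\|\nabla f\|_{L^2}^2-\frac{d(p-1)}{2(p+1)}\|f\|_{L^{p+1}}^{p+1},\qquad \|f\|_{\widetilde H^1}^2=\frac{d(p-1)-4}{d(p-1)}\|\nabla f\|_{L^2}^2+\|f\|_{L^2}^2,$$ $$\mathcal{N}_2(f)=\|f\|_{L^2}^{p+1-\frac d2(p-1)}\|\nabla f\|_{L^2}^{\frac d2(p-1)-2},\qquad \mathcal{I}(f)=\frac{\|f\|_{L^2}^{p+1-\frac d2(p-1)}\|\nabla f\|_{L^2}^{\frac d2(p-1)}}{\|f\|_{L^{p+1}}^{p+1}}\ (f\neq 0).$$ Define $$N_1=\inf\{\|f\|_{\widetilde H^1}^2: f\in H^1(\mathbb{R}^d)\setminus\{0\},\ \mathcal{K}(f)\le0\},\quad N_2=\inf\{\mathcal{N}_2(f): f\in H^1(\mathbb{R}^d)\setminus\{0\},\ \mathcal{K}(f)\le0\},\quad N_3=\inf\{\mathcal{I}(f): f\in H^1(\mathbb{R}^d)\setminus\{0\}\}.$$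 *)

(* Defs.v *)
From HB Require Import structures.
From mathcomp Require Import all_boot all_order all_algebra.
From mathcomp Require Import complex.
From mathcomp Require Import all_classical all_reals all_analysis.

Set Implicit Arguments.
Unset Strict Implicit.
Unset Printing Implicit Defensive.

Import Order.TTheory GRing.Theory Num.Theory.
Import numFieldTopology.Exports numFieldNormedType.Exports.

Local Open Scope classical_set_scope.
Local Open Scope ring_scope.

(* R^d is 'rV[R]_d with the sigma-algebra generated by the coordinates, i.e.
   the Borel sigma-algebra; same construction as the library's n.-tuple T. *)
Section measurable_rV.
Context {d : measure_display} {T : measurableType d}.
Variable n : nat.

Let coors : 'I_n -> 'rV[T]_n -> T := fun i v => v ord0 i.

Let rV_set0 : g_sigma_preimage coors set0.
Proof. exact: sigma_algebra0. Qed.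

Let rV_setC A : g_sigma_preimage coors A -> g_sigma_preimage coors (~` A).
Proof. exact: sigma_algebraC. Qed.

Let rV_bigcup (F : _^nat) : (forall i, g_sigma_preimage coors (F i)) ->
  g_sigma_preimage coors (\bigcup_i (F i)).
Proof. exact: sigma_algebra_bigcup. Qed.

HB.instance Definition _ := @isMeasurable.Build (measure_tuple_display d)
  'rV[T]_n (g_sigma_preimage coors) rV_set0 rV_setC rV_bigcup.

Lemma measurable_rV_coord (i : 'I_n) :
  measurable_fun [set: 'rV[T]_n] (fun v : 'rV[T]_n => v ord0 i).
Proof.
move=> _ Y mY; rewrite setTI; apply: sub_sigma_algebra.
rewrite -bigcup_seq/=; exists i; first by rewrite /= mem_index_enum.
by exists Y => //; rewrite setTI.
Qed.

Lemma measurable_fun_rVP d' (S : measurableType d') (f : S -> 'rV[T]_n) :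
  (forall i, measurable_fun [set: S] (fun x => f x ord0 i)) ->
  measurable_fun [set: S] f.
Proof.
move=> mf; apply: (@measurability _ _ _ _ _ _
  (\big[setU/set0]_(i < n) preimage_set_system setT (coors i) measurable)) => //.
move=> _ [B + <-].
rewrite -bigcup_seq/= => -[i _ [A mA <-]].
by rewrite !setTI; move: (mf i measurableT A mA); rewrite setTI.
Qed.

End measurable_rV.

Section sigma_finite_measureP.
Context d (T : measurableType d) (R : realType).
Variable mu : {measure set T -> \bar R}.

(* The unused proof argument makes the instances below apply to this alias only. *)
Definition as_sigma_finite of sigma_finite setT mu : set T -> \bar R := mu.

Variable musf : sigma_finite setT mu.

HB.instance Definition _ := Measure.on (as_sigma_finite musf).
HB.instance Definition _ :=
  Measure_isSigmaFinite.Build _ _ _ (as_sigma_finite musf) musf.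

Lemma sigma_finite_measureP :
  exists m : {sigma_finite_measure set T -> \bar R}, (mu : set T -> \bar R) = m.
Proof. by exists (as_sigma_finite musf). Qed.

End sigma_finite_measureP.

Section lebesgue_rV.
Variable R : realType.

Definition row_cons d (xv : R * 'rV[R]_d) : 'rV[R]_d.+1 :=
  row_mx xv.1%:M xv.2.

Lemma row_cons0 d (xv : R * 'rV[R]_d) : row_cons xv ord0 ord0 = xv.1.
Proof.
rewrite (_ : ord0 = lshift d (ord0 : 'I_1)); last exact: val_inj.
by apply: etrans (row_mxEl _ _ _ _) _; rewrite mxE.
Qed.

Lemma row_consS d (xv : R * 'rV[R]_d) (i : 'I_d) :
  row_cons xv ord0 (lift ord0 i) = xv.2 ord0 i.
Proof.
rewrite (_ : lift ord0 i = rshift 1 i); last exact: val_inj.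
exact: row_mxEr.
Qed.

Lemma measurable_row_cons d : measurable_fun setT (@row_cons d).
Proof.
apply: measurable_fun_rVP => i; have [j ->|->] := unliftP ord0 i.
- rewrite (_ : (fun _ => _) = (fun v : 'rV[R]_d => v ord0 j) \o snd).
    exact: measurableT_comp (measurable_rV_coord j) (@measurable_snd _ _ _ _).
  by apply/funext => x; rewrite row_consS.
- rewrite (_ : (fun _ => _) = fst); first exact: measurable_fst.
  by apply/funext => x; rewrite row_cons0.
Qed.

Fixpoint lebesgue_rV (d : nat) : set 'rV[R]_d -> \bar R :=
  match d with
  | 0 => \d_(0 : 'rV[R]_0)
  | d'.+1 => pushforward (lebesgue_measure \x lebesgue_rV (d := d'))%E
               (@row_cons d')
  end.

Let lebesgue_rV_struct d :
  exists mu : {sigma_finite_measure set 'rV[R]_d -> \bar R},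
    lebesgue_rV (d := d) = mu.
Proof.
elim: d => [|d [mu /= ->]]; first by exists \d_(0 : 'rV[R]_0).
pose leb := [the {sigma_finite_measure set (measurableTypeR R) -> \bar R} of
  lebesgue_measure].
(* The library's sigma-finite structure on products is shadowed by the one for
   finite measures, so sigma-finiteness is proved by hand. *)
have prodsf : sigma_finite setT (leb \x mu)%E.
  have /sigma_finiteP[F [TF ndF Foo]] := sigma_finiteT leb.
  have /sigma_finiteP[G [TG ndG Goo]] := sigma_finiteT mu.
  exists (fun n => F n `*` G n).
    rewrite -setXTT TF TG predeqE => -[x y]; split.
      move=> [/= [n _ Fnx] [k _ Gky]]; exists (maxn n k) => //; split.
      - by move: x Fnx; exact/subsetPset/ndF/leq_maxl.
      - by move: y Gky; exact/subsetPset/ndG/leq_maxr.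
    by move=> [n _ []/= ? ?]; split; exists n.
  move=> k; have [? ?] := Foo k; have [? ?] := Goo k.
  split; first exact: measurableX.
  by rewrite product_measure1E// lte_mul_pinfty// ge0_fin_numE.
pose nu := pushforward (leb \x mu)%E (@row_cons d).
pose hd (v : 'rV[R]_d.+1) : R * 'rV[R]_d :=
  (lsubmx (v : 'rV_(1 + d)) ord0 ord0, rsubmx (v : 'rV_(1 + d))).
have mhd : measurable_fun setT hd.
  apply/measurable_fun_pairP; split.
    rewrite (_ : _ \o _ =
      fun v : 'rV[R]_d.+1 => v ord0 (lshift d (ord0 : 'I_1))).
      exact: measurable_rV_coord.
    by apply/funext => v; rewrite /= mxE.
  apply: measurable_fun_rVP => i.
  rewrite (_ : (fun _ => _) = fun v : 'rV[R]_d.+1 => v ord0 (rshift 1 i)).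
    exact: measurable_rV_coord.
  by apply/funext => v; rewrite /= mxE.
have hdK xv : hd (row_cons xv) = xv.
  case: xv => x v; rewrite /hd /row_cons row_mxKl row_mxKr.
  by rewrite mxE eqxx mulr1n.
have nusf : sigma_finite setT nu.
  have [F FT Foo] := prodsf.
  exists (fun n => hd @^-1` F n).
    by rewrite -preimage_bigcup -FT preimage_setT.
  move=> n; have [mF Fy] := Foo n; split.
    by rewrite -[X in measurable X]setTI; exact: mhd.
  rewrite /nu /pushforward -comp_preimage.
  by rewrite (_ : hd \o _ = id)//; apply/funext => x /=; rewrite hdK.
exact: (sigma_finite_measureP
  (mu := measure_function_pushforward__canonical__measure_function_Measure
    (leb \x mu)%E (@measurable_row_cons d)) nusf).
Qed.

Let lebesgue_rV0 d : lebesgue_rV (d := d) set0 = 0%E.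
Proof. by have [mu ->] := lebesgue_rV_struct d; rewrite measure0. Qed.

Let lebesgue_rV_ge0 d A : (0 <= lebesgue_rV (d := d) A)%E.
Proof. by have [mu ->] := lebesgue_rV_struct d; exact: measure_ge0. Qed.

Let lebesgue_rV_sigma_additive d : semi_sigma_additive (lebesgue_rV (d := d)).
Proof.
by have [mu ->] := lebesgue_rV_struct d; exact: measure_semi_sigma_additive.
Qed.

HB.instance Definition _ d := isMeasure.Build _ _ _ (lebesgue_rV (d := d))
  (lebesgue_rV0 d) (@lebesgue_rV_ge0 d) (@lebesgue_rV_sigma_additive d).

Let lebesgue_rV_sigma_finite d : sigma_finite setT (lebesgue_rV (d := d)).
Proof. by have [mu ->] := lebesgue_rV_struct d; exact: sigma_finiteT. Qed.

HB.instance Definition _ d := Measure_isSigmaFinite.Build _ _ _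
  (lebesgue_rV (d := d)) (@lebesgue_rV_sigma_finite d).

Lemma lebesgue_rV_box d (A : 'I_d -> set R) : (forall i, measurable (A i)) ->
  lebesgue_rV [set v : 'rV[R]_d | forall i, A i (v ord0 i)] =
  (\prod_(i < d) lebesgue_measure (A i))%E.
Proof.
elim: d A => [|d IH] A mA.
  rewrite big_ord0 /= diracE (_ : _ \in _ = true)//.
  by apply/mem_set => -[].
have mA' : measurable [set v : 'rV[R]_d | forall i, A (lift ord0 i) (v ord0 i)].
  rewrite (_ : mkset _ = \bigcap_(i in [set: 'I_d])
      ((fun v : 'rV[R]_d => v ord0 i) @^-1` A (lift ord0 i))).
    apply: fin_bigcap_measurable => // i _.
    by rewrite -[X in measurable X]setTI; exact: measurable_rV_coord.
  by apply/seteqP; split => v Av i; [move=> _|]; exact: Av.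
rewrite big_ord_recl -IH//.
have [mu muE] := lebesgue_rV_struct d; rewrite muE /= muE /pushforward.
rewrite -(product_measure1E _ mu)//; last exact: mA.
congr (_ _); apply/seteqP; split => -[x v] /=.
  move=> Av; split => [|i]; first by have := Av ord0; rewrite row_cons0.
  by have := Av (lift ord0 i); rewrite row_consS.
move=> [Ax Av] i; have [j ->|->] := unliftP ord0 i.
  by rewrite row_consS.
by rewrite row_cons0.
Qed.

End lebesgue_rV.

Section sobolev.
Variables (R : realType) (d : nat).
Local Notation E := 'rV[R]_d.
Local Notation mu := (@lebesgue_rV R d).
Local Notation C := R[i].
Local Notation normc := ComplexField.Normc.normc.

Definition partial (i : 'I_d) (phi : E -> R) : E -> R :=
  fun x => 'D_(delta_mx ord0 i) (phi : E -> R^o) x.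

Definition iter_partial (s : seq 'I_d) (phi : E -> R) : E -> R :=
  foldr partial phi s.

Definition smooth (phi : E -> R) : Prop :=
  forall s : seq 'I_d, continuous (iter_partial s phi) /\
    forall (i : 'I_d) (x : E),
      derivable (iter_partial s phi : E -> R^o) x (delta_mx ord0 i).

Definition test_function (phi : E -> R) : Prop :=
  smooth phi /\ compact (closure [set x | phi x != 0]).

Definition measurable_C (f : E -> C) : Prop :=
  measurable_fun setT (fun x => complex.Re (f x)) /\
  measurable_fun setT (fun x => complex.Im (f x)).

Definition integral_C (f : E -> C) : C :=
  Complex (\int[mu]_x complex.Re (f x)) (\int[mu]_x complex.Im (f x)).

Definition LnormR (q : R) (f : E -> R) : \bar R :=
  ('N[mu]_(q%:E)[EFin \o f])%E.

Definition LnormC (q : R) (f : E -> C) : \bar R :=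
  LnormR q (fun x => normc (f x)).

Definition in_L2 (f : E -> C) : Prop :=
  measurable_C f /\ (LnormC 2 f < +oo)%E.

Definition weak_partial (i : 'I_d) (f g : E -> C) : Prop :=
  forall phi, test_function phi ->
    integral_C (fun x => f x * (partial i phi x)%:C%C) =
    - integral_C (fun x => g x * (phi x)%:C%C).

(* An element of H^1(R^d) is carried together with its weak gradient, which is
   determined by the function up to a null set. *)
Record H1 := MkH1 {
  H1_fun :> E -> C;
  H1_grad : 'I_d -> E -> C;
  H1_fun_L2 : in_L2 H1_fun;
  H1_grad_L2 : forall i, in_L2 (H1_grad i);
  H1_gradP : forall i, weak_partial i H1_fun (H1_grad i) }.

(* f <> 0 as an element of H^1, i.e. modulo equality almost everywhere. *)
Definition H1_nonzero (f : H1) : Prop := ~ {ae mu, forall x, f x = 0}.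

Definition gradnorm (f : H1) : \bar R :=
  LnormR 2 (fun x => Num.sqrt (\sum_(i < d) normc (H1_grad f i x) ^+ 2)).

End sobolev.

Section functionals.
Variables (R : realType) (d : nat) (p : R).
Local Notation D := (d%:R : R).
Local Open Scope ereal_scope.

(* The functionals are extended-real valued. On H^1 the L^2 norms of f and of
   its gradient are finite by definition; the L^(p+1) norm is finite by the
   Sobolev embedding when p + 1 < 2^*. *)
Definition calK (f : H1 R d) : \bar R :=
  gradnorm f ^+ 2 -
  (D * (p - 1) / (2 * (p + 1)))%:E * LnormC (p + 1) f `^ (p + 1).

Definition tildeH1_sqr (f : H1 R d) : \bar R :=
  ((D * (p - 1) - 4) / (D * (p - 1)))%:E * gradnorm f ^+ 2 +
  LnormC 2 f ^+ 2.

Definition calN2 (f : H1 R d) : \bar R :=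
  LnormC 2 f `^ (p + 1 - D / 2 * (p - 1)) *
  gradnorm f `^ (D / 2 * (p - 1) - 2).

Definition calI (f : H1 R d) : \bar R :=
  LnormC 2 f `^ (p + 1 - D / 2 * (p - 1)) *
  gradnorm f `^ (D / 2 * (p - 1)) /
  LnormC (p + 1) f `^ (p + 1).

Definition N1 : \bar R :=
  ereal_inf [set tildeH1_sqr f | f in
    [set f : H1 R d | H1_nonzero f /\ calK f <= 0]].

Definition N2 : \bar R :=
  ereal_inf [set calN2 f | f in
    [set f : H1 R d | H1_nonzero f /\ calK f <= 0]].

Definition N3 : \bar R :=
  ereal_inf [set calI f | f in [set f : H1 R d | H1_nonzero f]].

End functionals.

Definition two_star (R : realType) (d : nat) : \bar R :=
  if (d <= 2)%N then +oo%E else ((2 * d%:R) / (d%:R - 2))%:E.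

(* Main.v *)
Require Import Defs.
From HB Require Import structures.
From mathcomp Require Import all_boot all_order all_algebra.
From mathcomp Require Import complex.
From mathcomp Require Import all_classical all_reals all_analysis.
From mathcomp Require Import measurable_realfun.
From mathcomp Require Import ring lra.
Set Implicit Arguments.
Unset Strict Implicit.
Unset Printing Implicit Defensive.
Import Order.TTheory GRing.Theory Num.Theory.
Import numFieldTopology.Exports numFieldNormedType.Exports.
Local Open Scope classical_set_scope.
Local Open Scope ring_scope.

(** The proof is a scaling argument.  Write a and b for the L2 norms of f and of
its gradient, c for the (p+1)-st power of its L^(p+1) norm, al and be for the
exponents p + 1 - d (p - 1) / 2 and d (p - 1) / 2 - 2 of N_2, so that al and be
are positive with al + be = p - 1, and kap for the coefficient of c in K.
Multiplying f by a constant and dilating its argument turns the triple (a, b, c)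
into (s a, s nu b, s^(p+1) nu^(be+2) c), with s and nu > 0 free
([two_parameter_family]).  With t = s^(p-1) nu^be this multiplies N_2(f) by t
([family_calN2]) and turns K(f) <= 0 into b^2 <= t kap c ([family_calK]).

- N_3 = kap N_2.  If K(f) <= 0 then b^2 <= kap c, that is I(f) <= kap N_2(f).
  Conversely t = b^2 / (kap c) puts any f on the boundary of the constraint,
  where N_2 takes the value I(f) / kap.

- N_1 against N_2.  The weighted arithmetic-geometric mean inequality bounds a
  power of the functional minimised in N_1 below by a constant times N_2(f)
  ([sharp_const_le]).  Along the curve t = 1 both N_2(f) and the sign of K(f)
  are invariant while b / a takes every positive value, so the equality case of
  the inequality is attained there ([sharp_const_eq]).

The formulas b^2 / (kap c) and b / a degenerate when b = 0 or c is infinite.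
In those cases multiplying f by small constants respects the constraint and
sends the functionals to 0 ([N2_le0_degenerate]), so both identities reduce to
0 = 0.

The analytic work is to show that the rescaled function lies in H^1: Lebesgue
measure on R^d scales by nu^(-d) under dilations, and dilations map test
functions to test functions. *)

(** * Change of variables for a measure scaled by a bijection *)

Section change_of_variables.
Context d (T : measurableType d) (R : realType).
Variable mu : {measure set T -> \bar R}.
Local Open Scope ereal_scope.
Import HBNNSimple.

Lemma nnsfun_comp (h : {nnsfun T >-> R}) (phi : T -> T) :
  measurable_fun setT phi ->
  exists h' : {nnsfun T >-> R}, (h' : T -> R) = h \o phi.
Proof.
move=> mphi.
have mh : measurable_fun setT (h \o phi) by exact: measurableT_comp.
have fh : finite_set (range (h \o phi)).
  apply: (sub_finite_set _ (@fimfunP _ _ h)).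
  by move=> _ [x _ <-]; exists (phi x).
have h0 x : (0 <= (h \o phi) x)%R by exact: fun_ge0.
pose h' : {nnsfun T >-> R} := HB.pack (h \o phi)
  (@isMeasurableFun.Build _ _ _ _ _ mh) (@FiniteImage.Build _ _ _ fh)
  (@isNonNegFun.Build _ _ _ h0).
by exists h'.
Qed.

(** A simple function h below f gives the simple function k (h o phi) below
k (f o phi), whose integral is k c times that of h; the supremum over h then
gives the inequality for an arbitrary nonnegative f. *)
Lemma ge0_le_integral_scaled (phi : T -> T) (c k : R) (f : T -> \bar R) :
  measurable_fun setT phi -> (0 < c)%R -> (0 < k)%R ->
  (forall A, measurable A -> mu (phi @^-1` A) = c%:E * mu A) ->
  (forall x, 0 <= f x) ->
  (k * c)%:E * \int[mu]_x f x <= \int[mu]_x (k%:E * f (phi x)).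
Proof.
move=> mphi c0 k0 muphi f0; have kc0 : (0 < k * c)%R by exact: mulr_gt0.
rewrite -lee_pdivlMl// !ge0_integralTE//; last first.
  by move=> x; rewrite mule_ge0// lee_fin ltW.
apply: ge_ereal_sup => _ [h /= hf <-]; rewrite lee_pdivlMl//.
have [h' h'E] := nnsfun_comp h mphi.
have -> : (k * c)%:E * sintegral mu h = sintegral mu (scale_nnsfun h' (ltW k0)).
  rewrite [RHS](sintegralrM mu k h') h'E EFinM -muleA; congr (_ * _).
  rewrite !sintegralET ge0_mule_fsumr; last exact: nnsfun_mulemu_ge0.
  apply: eq_fsbigr => x _; set A := h @^-1` _.
  rewrite -[(h \o phi) @^-1` _]/(phi @^-1` A) muphi; first by rewrite muleCA.
  exact: measurable_sfunP.
apply: ereal_sup_ubound; exists (scale_nnsfun h' (ltW k0)) => // x /=.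
by rewrite h'E /= EFinM lee_pmul2l.
Qed.

(** The reverse inequality is the previous one for the inverse map, under which
the measure scales by the inverse factor. *)
Lemma ge0_integral_scaled (phi psi : T -> T) (c k : R) (f : T -> \bar R) :
  measurable_fun setT phi -> measurable_fun setT psi ->
  cancel phi psi -> cancel psi phi -> (0 < c)%R -> (0 < k)%R ->
  (forall A, measurable A -> mu (phi @^-1` A) = c%:E * mu A) ->
  (forall x, 0 <= f x) ->
  \int[mu]_x (k%:E * f (phi x)) = (k * c)%:E * \int[mu]_x f x.
Proof.
move=> mphi mpsi phiK psiK c0 k0 muphi f0; apply/eqP; rewrite eq_le.
apply/andP; split; last exact: ge0_le_integral_scaled.
have mupsi A : measurable A -> mu (psi @^-1` A) = c^-1%:E * mu A.
  move=> mA; have mA' : measurable (psi @^-1` A).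
    by rewrite -[X in measurable X]setTI; exact: mpsi.
  rewrite -[in RHS](_ : phi @^-1` (psi @^-1` A) = A); last first.
    by rewrite -comp_preimage (_ : psi \o phi = id)//; exact/funext.
  by rewrite muphi// muleA -EFinM mulVf ?mul1e// gt_eqF.
have kV0 : (0 < k^-1)%R by rewrite invr_gt0.
have cV0 : (0 < c^-1)%R by rewrite invr_gt0.
rewrite -lee_pdivrMl ?mulr_gt0// invfM.
apply: le_trans (ge0_le_integral_scaled mpsi cV0 kV0 mupsi _) _.
  by move=> x; rewrite mule_ge0// lee_fin ltW.
rewrite le_eqVlt; apply/orP; left; apply/eqP; apply: eq_integral => x _.
by rewrite psiK muleA -EFinM mulVf ?mul1e// gt_eqF.
Qed.

(** Applied below to products of a Sobolev function with a derivative of a test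
function, hence stated for an arbitrary f: the positive and negative parts are
transported separately, and the indeterminate cases of the subtraction and of
the real-valued truncation are compatible with a positive factor. *)
Lemma Rintegral_scaled (phi psi : T -> T) (c k : R) (f : T -> R) :
  measurable_fun setT phi -> measurable_fun setT psi ->
  cancel phi psi -> cancel psi phi -> (0 < c)%R -> (0 < k)%R ->
  (forall A, measurable A -> mu (phi @^-1` A) = c%:E * mu A) ->
  (\int[mu]_x (k * f (phi x)) = k * c * \int[mu]_x f x)%R.
Proof.
move=> mphi mpsi phiK psiK c0 k0 muphi; rewrite /Rintegral.

have kc0 : (0 < k * c)%R by exact: mulr_gt0.
have fineZ r (x : \bar R) : (0 < r)%R -> fine (r%:E * x) = (r * fine x)%R.
  by case: x => [s| |] r0; rewrite ?gt0_muley ?gt0_muleNy //= mulr0.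
have muleZB r (x y : \bar R) : (0 < r)%R -> r%:E * (x - y) = r%:E * x - r%:E * y.
  move=> r0; case: x y => [x| |] [y| |]//=; rewrite ?gt0_muley ?gt0_muleNy//=.
  by rewrite -!EFinD -!EFinM mulrBr.
rewrite -fineZ//; congr fine; rewrite integralE [in RHS]integralE muleZB//.
rewrite -!(@ge0_integral_scaled phi psi)//.
have k00 : 0 <= k%:E by rewrite lee_fin ltW.
congr (_ - _); apply: eq_integral => x _.
  by rewrite !funeposE EFinM maxe_pMr// mule0.
by rewrite !funenegE EFinM -muleN maxe_pMr// mule0.
Qed.
End change_of_variables.

(** * Lebesgue measure under dilations *)

Section dilation_measure.
Variable R : realType.
Local Open Scope ereal_scope.

Definition dilation d (nu : R) (x : 'rV[R]_d) : 'rV[R]_d := (nu *: x)%R.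

Lemma dilationK d (nu : R) : (nu != 0)%R -> cancel (@dilation d nu) (dilation nu^-1).
Proof. by move=> nu0 x; rewrite /dilation scalerA mulVf// scale1r. Qed.

Lemma measurable_dilation d (nu : R) : measurable_fun setT (@dilation d nu).
Proof.
apply: measurable_fun_rVP => i.
rewrite (_ : (fun _ => _) = fun v : 'rV[R]_d => (nu * v ord0 i)%R).
  exact: measurableT_comp (mulrl_measurable nu) (measurable_rV_coord i).
by apply/funext => v; rewrite mxE.
Qed.

(** Lebesgue measure is determined by its values on half-open intervals, and nu
times its image under multiplication by nu has the same values there. *)
Lemma lebesgue_measure_dilation (nu : R) (A : set R) : (0 < nu)%R ->
  measurable A ->
  lebesgue_measure ( *%R nu @^-1` A) = (nu^-1)%:E * lebesgue_measure A.
Proof.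
move=> nu0 mA.
have mnu : measurable_fun [set: measurableTypeR R]
  ( *%R nu : _ -> measurableTypeR R).
  exact: mulrl_measurable.
pose m := mscale (NngNum (ltW nu0))
  (pushforward lebesgue_measure ( *%R nu : _ -> measurableTypeR R)).
have E : forall B : set (measurableTypeR R), measurable B -> lebesgue_measure B = m mnu B.
  apply: (@lebesgue_measure_unique R (m mnu)).
  move=> _ [[a b] _ <-] /=.
  rewrite /m/= /mscale/= /pushforward.
  rewrite (_ : *%R nu @^-1` _ = `](nu^-1 * a)%R, (nu^-1 * b)%R]%classic); last first.
    apply/seteqP; split => x /=; rewrite !in_itv/=.
      by rewrite ltr_pdivrMl// ler_pdivlMl.
    by rewrite ltr_pdivrMl// ler_pdivlMl.
  rewrite !lebesgue_measure_itv/= !lte_fin ltr_pM2l ?invr_gt0//.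
  case: ifP => _; last by rewrite mule0.
  by rewrite -!EFinB -EFinM -mulrBr mulVKf// gt_eqF.
by rewrite [in RHS]E// /m/= /mscale/= muleA -EFinM mulVf ?mul1e// gt_eqF.
Qed.

Lemma row_cons_dilation d (nu x : R) (v : 'rV[R]_d) :
  (nu *: row_cons (x, v) = row_cons (nu * x, nu *: v))%R.
Proof.
apply/rowP => i; rewrite mxE; have [j ->|->] := unliftP ord0 i.
  by rewrite !row_consS mxE.
by rewrite !row_cons0.
Qed.

(** Induction on the dimension: the slices of a dilated set are dilated slices,
which gives nu^(-d), and the change of variables in the outer integral over the
first coordinate gives the last factor. *)
Lemma lebesgue_rV_dilation d (nu : R) (A : set 'rV[R]_d) : (0 < nu)%R ->
  measurable A ->
  lebesgue_rV (dilation nu @^-1` A) = ((nu ^- d)%R)%:E * lebesgue_rV A.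
Proof.
move=> nu0; elim: d A => [|d IH] A mA.
  rewrite expr0 invr1 mul1e; congr lebesgue_rV; apply/seteqP; split => x /=;
  by rewrite /dilation [(nu *: x)%R]thinmx0 [x]thinmx0.
rewrite /= /pushforward /product_measure1.
have mA' : measurable (@row_cons R d @^-1` A).
  by rewrite -[X in measurable X]setTI; exact: measurable_row_cons.
have nud : (0 < nu ^- d)%R by rewrite invr_gt0 exprn_gt0.
have nuV : (0 < nu^-1)%R by rewrite invr_gt0.
have nuN : (nu != 0)%R by rewrite gt_eqF.
rewrite exprS invfM mulrC -(@ge0_integral_scaled _ _ _ lebesgue_measure
  ( *%R nu) ( *%R nu^-1))//.
- apply: eq_integral => x _ /=; rewrite -IH; last exact: measurable_xsection.
  congr lebesgue_rV; apply/seteqP.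
  rewrite /xsection; split => v /=; rewrite !inE /= !/dilation => Av.
    by rewrite -row_cons_dilation.
  by rewrite row_cons_dilation.
- exact: mulKf.
- exact: mulVKf.
- by move=> B mB; exact: lebesgue_measure_dilation.
Qed.
End dilation_measure.

(** * Test functions under dilations *)

Section dilation_test.
Variables (R : realType) (d : nat).
Local Notation E := 'rV[R]_d.
Implicit Types (phi : E -> R) (c nu : R).

(** Reduces directional derivatives to one real variable, where the chain rule
is available from derivability alone. *)
Lemma derive_line (f : E -> R^o) (x v : E) :
  'D_v f x = 'D_1 (fun h : R => f (h *: v + x)) 0.
Proof.
rewrite /derive; set g1 := fun h => h^-1 *: _; set g2 := fun h => h^-1 *: _.
suff -> : g1 = g2 by [].
by apply/funext => h; rewrite /g1 /g2 /= addr0 scale0r add0r [_%:A]mulr1.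
Qed.

Lemma is_derive_dilation phi c nu (x v : E) :
  derivable (phi : E -> R^o) (dilation nu x) v ->
  is_derive x v ((fun y => c * phi (dilation nu y)) : E -> R^o)
    (c * nu * 'D_v (phi : E -> R^o) (dilation nu x)).
Proof.
move=> dphi.
pose F (h : R) : R := phi (h *: v + dilation nu x).
have dF : is_derive (nu * 0) 1 F ('D_v (phi : E -> R^o) (dilation nu x)).
  rewrite mulr0 derive_line; split => //; exact: (derivable1P _ _ _).1 dphi.
have dm : is_derive (0 : R) 1 (fun h : R => nu * h) nu.
  have := @is_deriveZ R R^o R^o id nu 0 1 1 (is_derive_id _ _).
  by rewrite [_ *: _]mulr1.
have dFm : is_derive (0 : R) 1 (F \o *%R nu)
  (nu * 'D_v (phi : E -> R^o) (dilation nu x)).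
  by rewrite mulrC; exact: is_derive1_comp.
have dG : is_derive (0 : R) 1 (c \*: (F \o *%R nu))
    (c * nu * 'D_v (phi : E -> R^o) (dilation nu x)).
  by rewrite -mulrA; exact: is_deriveZ.
have FE : c \*: (F \o *%R nu) =
   (fun h : R => (fun y => c * phi (dilation nu y)) (h *: v + x)).
  apply/funext => h; congr (c * phi _).
  by rewrite /dilation scalerDr scalerA.
rewrite FE in dG; split; first by apply/derivable1P; case: dG.
by rewrite derive_line; case: dG.
Qed.

Lemma continuous_dilation nu : continuous (@dilation R d nu).
Proof. by move=> x; exact: scaler_continuous. Qed.

Lemma iter_partial_dilation (s : seq 'I_d) phi c nu : smooth phi ->
  iter_partial s (fun y => c * phi (dilation nu y)) =
  (fun y => (c * nu ^+ size s) * iter_partial s phi (dilation nu y)).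
Proof.
move=> sphi; elim: s => [|i s IH] /=; first by rewrite expr0 mulr1.
rewrite IH; apply/funext => x; rewrite /partial.
have [_ /(_ i (dilation nu x)) dphi] := sphi s.
rewrite (derive_val (is_derive := is_derive_dilation _ dphi)).
by rewrite exprSr mulrA.
Qed.

Lemma test_function_dilation phi c nu : nu != 0 ->
  test_function phi -> test_function (fun y => c * phi (dilation nu y)).
Proof.
move=> nu0 [sphi cphi]; split.
  move=> s; rewrite iter_partial_dilation//; have [cs ds] := sphi s; split.
    move=> x; have cx : {for x, continuous (iter_partial s phi \o dilation nu)}.
      apply: continuous_comp; first exact: continuous_dilation.
      exact: cs.
    exact: (@continuousM _ _ (cst (c * nu ^+ size s)) _ x (@cst_continuous _ _ _ x) cx).
  by move=> i x; case: (is_derive_dilation (c * nu ^+ size s) (ds i (dilation nu x))).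
(* the closed support is carried into the image of the original one *)
pose K := dilation nu^-1 @` closure [set x | phi x != 0].
have cK : compact K.
  apply: continuous_compact => //.
  by apply: continuous_subspaceT; exact: continuous_dilation.
have clK : closed K by apply: compact_closed => //; exact: norm_hausdorff.
apply: (subclosed_compact _ cK); first exact: closed_closure.
rewrite ((closure_id K).1 clK).
apply: closure_subset => x /=; rewrite mulf_eq0 negb_or => /andP[_ phix].
exists (dilation nu x); first exact: subset_closure.
by rewrite dilationK.
Qed.

End dilation_test.

(** * Rescaled Sobolev functions and their norms *)

Section rescaling.
Variables (R : realType) (d : nat).
Local Notation E := 'rV[R]_d.
Local Notation mu := (@lebesgue_rV R d).
Local Notation C := R[i].
Local Notation normc := ComplexField.Normc.normc.
Implicit Types (lam nu q : R).

Definition rescale lam nu (u : E -> C) (x : E) : C :=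
  lam%:C%C * u (dilation nu x).

Lemma Re_scale lam (z : C) : complex.Re (lam%:C%C * z) = lam * complex.Re z.
Proof. by case: z => a b /=; rewrite mul0r subr0. Qed.

Lemma Im_scale lam (z : C) : complex.Im (lam%:C%C * z) = lam * complex.Im z.
Proof. by case: z => a b /=; rewrite mul0r addr0. Qed.

Lemma normc_scale lam (z : C) : 0 <= lam -> normc (lam%:C%C * z) = lam * normc z.
Proof.
move=> lam0; rewrite ComplexField.Normc.normcM; congr (_ * _).
by rewrite /= expr0n addr0 sqrtr_sqr ger0_norm.
Qed.

Lemma measurable_C_rescale lam nu u :
  measurable_C u -> measurable_C (rescale lam nu u).
Proof.
move=> [mr mi]; split.
  rewrite (_ : (fun _ => _) = *%R lam \o (fun x => complex.Re (u x)) \o dilation nu).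
    apply: measurableT_comp; last exact: measurable_dilation.
    by apply: measurableT_comp => //; exact: mulrl_measurable.
  by apply/funext => x; rewrite /rescale Re_scale.
rewrite (_ : (fun _ => _) = *%R lam \o (fun x => complex.Im (u x)) \o dilation nu).
  apply: measurableT_comp; last exact: measurable_dilation.
  by apply: measurableT_comp => //; exact: mulrl_measurable.
by apply/funext => x; rewrite /rescale Im_scale.
Qed.

Lemma Rintegral_dilation lam nu (f : E -> R) : 0 < lam -> 0 < nu ->
  \int[mu]_x (lam * f (dilation nu x)) = lam * nu ^- d * \int[mu]_x f x.
Proof.
move=> lam0 nu0; have nuN : nu != 0 by rewrite gt_eqF.
apply: (@Rintegral_scaled _ _ _ mu (dilation nu) (dilation nu^-1)) => //.
- exact: measurable_dilation.
- exact: measurable_dilation.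
- exact: dilationK.
- by rewrite -{2}[nu]invrK; apply: dilationK; rewrite invr_eq0.
- by rewrite invr_gt0 exprn_gt0.
- by move=> A mA; exact: lebesgue_rV_dilation.
Qed.

Lemma integral_C_rescale lam nu (u : E -> C) (w : E -> R) : 0 < lam -> 0 < nu ->
  integral_C (fun x => rescale lam nu u x * (w x)%:C%C) =
  (lam * nu ^- d)%:C%C *
    integral_C (fun y => u y * (w (dilation nu^-1 y))%:C%C).
Proof.
move=> lam0 nu0; have nuN : nu != 0 by rewrite gt_eqF.
apply/eqP; rewrite eq_complex; apply/andP; split; apply/eqP.
  rewrite Re_scale /= -Rintegral_dilation//; apply: eq_Rintegral => x _.
  by rewrite /rescale dilationK// -mulrA Re_scale.
rewrite Im_scale /= -Rintegral_dilation//; apply: eq_Rintegral => x _.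
by rewrite /rescale dilationK// -mulrA Im_scale.
Qed.

(** Changing variables moves the dilation from f to the test function phi; the
chain rule for phi, compensated by the factor nu in psi, then allows the weak
derivative of f to be tested against psi. *)
Lemma weak_partial_rescale lam nu (i : 'I_d) (f g : E -> C) :
  0 < lam -> 0 < nu -> weak_partial i f g ->
  weak_partial i (rescale lam nu f) (rescale (lam * nu) nu g).
Proof.
move=> lam0 nu0 fg phi tphi; have nuN : nu != 0 by rewrite gt_eqF.
pose psi y := nu * phi (dilation nu^-1 y).
have tpsi : test_function psi by apply: test_function_dilation => //; rewrite invr_eq0.
have dpsi : partial i psi = fun y => partial i phi (dilation nu^-1 y).
  rewrite -[LHS]/(iter_partial [:: i] psi) iter_partial_dilation ?tphi.1//.
  by apply/funext => y; rewrite expr1 divff// mul1r.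
  by case: tphi.
rewrite (_ : (fun x => rescale (lam * nu) nu g x * (phi x)%:C%C) =
  fun x => rescale lam nu g x * (nu * phi x)%:C%C); last first.
  by apply/funext => x; rewrite /rescale !rmorphM /=; ring.
rewrite !integral_C_rescale// -[X in _ = - (_ * X)]opprK -/(psi _).
by rewrite -fg// dpsi mulrN opprK.
Qed.

Local Open Scope ereal_scope.

Lemma LnormR_pow_rescale q lam nu (F G : E -> R) : (0 < q)%R ->
  (0 < lam)%R -> (0 < nu)%R -> (forall x, G x = lam * F (dilation nu x))%R ->
  LnormR q G `^ q = ((lam `^ q * nu ^- d)%R)%:E * LnormR q F `^ q.
Proof.
move=> q0 lam0 nu0 GF; have nuN : (nu != 0)%R by rewrite gt_eqF.
rewrite /LnormR !poweR_Lnorm ?gt_eqF//.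
rewrite -(@ge0_integral_scaled _ _ _ mu (dilation nu) (dilation nu^-1)) => //.
- apply: eq_integral => x _ /=; rewrite GF normrM gtr0_norm// powRM//.
  exact: ltW.
- exact: measurable_dilation.
- exact: measurable_dilation.
- exact: dilationK.
- by rewrite -{2}[nu]invrK; apply: dilationK; rewrite invr_eq0.
- by rewrite invr_gt0 exprn_gt0.
- exact: powR_gt0.
- by move=> A mA; exact: lebesgue_rV_dilation.
- by move=> x; exact: poweR_ge0.
Qed.

Lemma LnormR_rescale q lam nu (F G : E -> R) : (0 < q)%R ->
  (0 < lam)%R -> (0 < nu)%R -> (forall x, G x = lam * F (dilation nu x))%R ->
  LnormR q G = ((lam * nu `^ (- (d%:R / q)))%R)%:E * LnormR q F.
Proof.
move=> q0 lam0 nu0 GF; have qN : (q != 0)%R by rewrite gt_eqF.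
have K (x : \bar R) : 0 <= x -> (x `^ q) `^ q^-1 = x.
  by move=> x0; rewrite -poweRrM divff// poweRe1.
rewrite -[LHS]K ?Lnorm_ge0// (LnormR_pow_rescale q0 lam0 nu0 GF).
rewrite poweRM ?poweR_ge0//; last first.
  by rewrite lee_fin mulr_ge0 ?powR_ge0// invr_ge0 exprn_ge0// ltW.
rewrite K ?Lnorm_ge0//; congr (_ * _); rewrite poweR_EFin; congr EFin.
rewrite powRM ?powR_ge0//; last by rewrite invr_ge0 exprn_ge0// ltW.
rewrite -powRrM divff// powRr1 ?ltW//; congr (_ * _)%R.
by rewrite -powR_invn ?ltW// -powRrM mulNr.
Qed.

Lemma LnormC_rescale q lam nu (u : E -> C) : (0 < q)%R ->
  (0 < lam)%R -> (0 < nu)%R ->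
  LnormC q (rescale lam nu u) =
  ((lam * nu `^ (- (d%:R / q)))%R)%:E * LnormC q u.
Proof.
move=> q0 lam0 nu0; apply: LnormR_rescale => // x.
by rewrite /rescale normc_scale// ltW.
Qed.

Lemma in_L2_rescale lam nu u : (0 < lam)%R -> (0 < nu)%R ->
  in_L2 u -> in_L2 (rescale lam nu u).
Proof.
move=> lam0 nu0 [mu' fu]; split; first exact: measurable_C_rescale.
rewrite LnormC_rescale// lte_mul_pinfty// lee_fin.
by rewrite mulr_ge0 ?powR_ge0// ltW.
Qed.

Definition H1_rescale lam nu (lam0 : (0 < lam)%R) (nu0 : (0 < nu)%R)
    (f : H1 R d) : H1 R d :=
  @MkH1 R d (rescale lam nu f) (fun i => rescale (lam * nu) nu (H1_grad f i))
    (in_L2_rescale lam0 nu0 (H1_fun_L2 f))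
    (fun i => in_L2_rescale (mulr_gt0 lam0 nu0) nu0 (H1_grad_L2 f i))
    (fun i => weak_partial_rescale lam0 nu0 (@H1_gradP R d f i)).

Lemma gradnorm_rescale lam nu (lam0 : (0 < lam)%R) (nu0 : (0 < nu)%R)
    (f : H1 R d) :
  gradnorm (H1_rescale lam0 nu0 f) =
  ((lam * nu * nu `^ (- (d%:R / 2)))%R)%:E * gradnorm f.
Proof.
have ln0 : (0 < lam * nu)%R by exact: mulr_gt0.
apply: LnormR_rescale => // x /=; rewrite /rescale.
under eq_bigr do rewrite normc_scale ?(ltW ln0)// exprMn.
by rewrite -mulr_sumr sqrtrM ?sqr_ge0// sqrtr_sqr gtr0_norm.
Qed.

Lemma measurable_normc u : measurable_C u ->
  measurable_fun setT (fun x : E => normc (u x)).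
Proof.
move=> [mr mi].
rewrite (_ : (fun _ => _) = fun x =>
  Num.sqrt (complex.Re (u x) ^+ 2 + complex.Im (u x) ^+ 2))%R; last first.
  by apply/funext => x; case: (u x).
apply: measurableT_comp; last first.
  apply: measurable_funD; exact: measurable_funX.
apply: continuous_measurable_fun; exact: sqrt_continuous.
Qed.

(** Turns nonvanishing modulo null sets into an inequality that is visibly
stable under rescaling. *)
Lemma LnormC_gt0 q (f : H1 R d) : (0 < q)%R -> 0 < LnormC q f <-> H1_nonzero f.
Proof.
move=> q0; have [mf _] := H1_fun_L2 f; have mnf := measurable_normc mf.
have mE : measurable_fun setT (EFin \o (fun x : E => normc (f x))) by exact/measurable_EFinP.
split.
  move=> /[swap] f0; rewrite lt_neqAle => /andP[/eqP + _]; apply.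
  rewrite /LnormC /LnormR unlock.
  rewrite (ae_eq_integral (cst 0)) ?integral0 ?poweR0r ?invr_neq0 ?gt_eqF//.
    apply: (measurableT_comp (measurable_poweR q)).
    exact: measurableT_comp mE.
  apply: filterS f0 => x fx _ /=.
  by rewrite fx ComplexField.Normc.normc0 normr0 powR0 ?gt_eqF.
move=> f0; rewrite lt_neqAle Lnorm_ge0 andbT; apply/eqP => /esym N0; apply: f0.
have := Lnorm_eq0_eq0 mE _ N0; rewrite lte_fin => /(_ q0).
by apply: filterS => x /(_ I) /= [] /ComplexField.Normc.eq0_normc.
Qed.

Lemma gradnorm_lty (f : H1 R d) : gradnorm f < +oo.
Proof.
apply: (@lty_poweRy _ _ 2) => //.
rewrite /gradnorm /LnormR poweR_Lnorm//.
under eq_integral => x _.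
  rewrite /= powR_mulrn ?normr_ge0// real_normK ?num_real// sqr_sqrtr;
    last by apply: sumr_ge0 => *; exact: sqr_ge0.
  rewrite -sumEFin; over.
rewrite ge0_integral_sum//=; last 2 first.
- move=> i; apply/measurable_EFinP; apply: measurable_funX.
  by apply: measurable_normc; case: (H1_grad_L2 f i).
- by move=> i x _; rewrite lee_fin sqr_ge0.
apply: lte_sum_pinfty => i _.
have [_ /(poweR_lty 2)] := H1_grad_L2 f i.
rewrite /LnormC /LnormR poweR_Lnorm//; apply: le_lt_trans.
rewrite le_eqVlt; apply/orP; left; apply/eqP; apply: eq_integral => x _ /=.
by rewrite powR_mulrn ?normr_ge0// real_normK ?num_real.
Qed.

End rescaling.

(** * The sharp inequality between the two scaling-invariant quantities *)

Section amgm.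
Variable R : realType.
Implicit Types (D p al be a b : R).

(** With al the exponent of the L2 norm in N_2, this is the constant relating
N_1^((p-1)/2) to N_2, written using (d+2) - (d-2) p = 2 al. *)
Definition sharp_const D p al : R :=
  (2 / D) `^ ((p - 1) / 2) * (D * (p - 1) / (2 * al)) `^ (al / 2).

Lemma sharp_const_gt0 D p al : 0 < D -> 1 < p -> 0 < al -> 0 < sharp_const D p al.
Proof.
move=> D0 p1 al0; rewrite mulr_gt0// powR_gt0 ?divr_gt0 ?mulr_gt0// subr_gt0//.
Qed.

Lemma weighted_amgm (w1 w2 x y : R) : 0 < w1 -> 0 < w2 -> w1 + w2 = 1 ->
  0 <= x -> 0 <= y -> x `^ w1 * y `^ w2 <= w1 * x + w2 * y.
Proof.
move=> w10 w20 w12 x0 y0.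
have := @conjugate_powR R (x `^ w1) (y `^ w2) w1^-1 w2^-1 (powR_ge0 _ _) (powR_ge0 _ _).
rewrite !invr_gt0 !invrK => /(_ w10 w20 w12).
by rewrite -!powRrM !divff ?gt_eqF// !powRr1// ![_ * w1]mulrC ![_ * w2]mulrC.
Qed.

Lemma powR_sqr a r : 0 <= a -> (a ^+ 2) `^ r = a `^ (2 * r).
Proof. by move=> a0; rewrite -powR_mulrn// powRrM. Qed.

(** Weighted arithmetic-geometric mean inequality with weights be / (p - 1) and
al / (p - 1), applied to 2 b^2 / D and (p - 1) a^2 / al: these are the two
summands of the right-hand side divided by their weights. *)
Lemma sharp_const_le D p al be a b : 0 < D -> 1 < p -> 0 < al -> 0 < be ->
  al + be = p - 1 -> 0 < a -> 0 <= b ->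
  sharp_const D p al * (a `^ al * b `^ be) <=
  (2 * be / (D * (p - 1)) * b ^+ 2 + a ^+ 2) `^ ((p - 1) / 2).
Proof.
move=> D0 p1 al0 be0 albe a0 b0; have p10 : 0 < p - 1 by rewrite subr_gt0.
have DN : D != 0 by rewrite gt_eqF.
have pN : p - 1 != 0 by rewrite gt_eqF.
have aN : al != 0 by rewrite gt_eqF.
have bN : be != 0 by rewrite gt_eqF.
have D20 : 0 <= 2 / D by rewrite ltW// divr_gt0.
have pa0 : 0 <= (p - 1) / al by rewrite ltW// divr_gt0.
have b20 : 0 <= 2 / D * b ^+ 2 by rewrite mulr_ge0// sqr_ge0.
have a20 : 0 <= (p - 1) / al * a ^+ 2 by rewrite mulr_ge0// sqr_ge0.
have w12 : be / (p - 1) + al / (p - 1) = 1 by rewrite -mulrDl addrC albe divff.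
have := weighted_amgm (divr_gt0 be0 p10) (divr_gt0 al0 p10) w12 b20 a20.
rewrite (_ : _ + _ = 2 * be / (D * (p - 1)) * b ^+ 2 + a ^+ 2); last first.
  by field; rewrite DN pN aN.
have hp0 : 0 <= (p - 1) / 2 by rewrite ltW// divr_gt0.
move=> /(ge0_ler_powR hp0); rewrite !nnegrE => H; apply: (le_trans _ (H _ _)); last 2 first.
- by rewrite mulr_ge0// powR_ge0.
- by rewrite addr_ge0 ?sqr_ge0// mulr_ge0 ?sqr_ge0// ltW// divr_gt0 ?mulr_gt0.
rewrite (powRM _ (powR_ge0 _ _) (powR_ge0 _ _)) -!powRrM.
rewrite (_ : be / (p - 1) * ((p - 1) / 2) = be / 2); last by field.
rewrite (_ : al / (p - 1) * ((p - 1) / 2) = al / 2); last by field.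
rewrite (powRM _ D20) ?sqr_ge0// (powRM _ pa0) ?sqr_ge0//.
rewrite !powR_sqr// ?(ltW a0)// ![2 * (_ / 2)]mulrC !divfK//.
rewrite /sharp_const (_ : D * (p - 1) / (2 * al) = (2 / D)^-1 * ((p - 1) / al)); last first.
  by field; rewrite DN aN.
rewrite (powRM _ _ pa0) ?invr_ge0// -(powR_inv1 D20) -powRrM.
rewrite [X in X * _]mulrA -powRD; last first.
  by rewrite (gt_eqF (divr_gt0 _ D0))// implybT.
rewrite (_ : (p - 1) / 2 + -1 * (al / 2) = be / 2); last by rewrite -albe; field.
by rewrite le_eqVlt; apply/orP; left; apply/eqP; ring.
Qed.

(** The hypothesis on b says that the two numbers whose weighted means are
compared coincide, which is the equality case. *)
Lemma sharp_const_eq D p al be a b : 0 < D -> 1 < p -> 0 < al -> 0 < be ->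
  al + be = p - 1 -> 0 < a -> 0 < b ->
  b ^+ 2 = D * (p - 1) / (2 * al) * a ^+ 2 ->
  (2 * be / (D * (p - 1)) * b ^+ 2 + a ^+ 2) `^ ((p - 1) / 2) =
  sharp_const D p al * (a `^ al * b `^ be).
Proof.
move=> D0 p1 al0 be0 albe a0 b0 b2; have p10 : 0 < p - 1 by rewrite subr_gt0.
have DN : D != 0 by rewrite gt_eqF.
have pN : p - 1 != 0 by rewrite gt_eqF.
have aN : al != 0 by rewrite gt_eqF.
set X := D * (p - 1) / (2 * al) in b2 *.
have X0 : 0 < X by rewrite divr_gt0 ?mulr_gt0.
have D20 : 0 < 2 / D by rewrite divr_gt0.
have -> : b `^ be = X `^ (be / 2) * a `^ be.
  rewrite -[LHS](_ : (b ^+ 2) `^ (be / 2) = _); last first.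
    by rewrite powR_sqr ?ltW// mulrC divfK.
  by rewrite b2 powRM ?sqr_ge0 ?ltW// powR_sqr ?ltW// [2 * _]mulrC divfK.
have -> : 2 * be / (D * (p - 1)) * b ^+ 2 + a ^+ 2 = (2 / D) * X * a ^+ 2.
  rewrite b2 /X (_ : be = p - 1 - al); last by rewrite -albe addrAC subrr add0r.
  by field; rewrite DN pN aN.
rewrite (powRM _ (mulr_ge0 (ltW D20) (ltW X0))) ?sqr_ge0//.
rewrite (powRM _ (ltW D20) (ltW X0)) powR_sqr ?(ltW a0)//.
rewrite [2 * (_ / 2)]mulrC divfK// /sharp_const -/X.
have -> : X `^ ((p - 1) / 2) = X `^ (al / 2) * X `^ (be / 2).
  by rewrite -powRD ?(gt_eqF X0) ?implybT// -mulrDl albe.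
have -> : a `^ (p - 1) = a `^ al * a `^ be.
  by rewrite -powRD ?(gt_eqF a0) ?implybT// albe.
ring.
Qed.

End amgm.

(** * Comparison of the three infima *)

Section variational.
Variables (R : realType) (d : nat) (p : R).
Local Notation D := (d%:R : R).
Local Notation al := (p + 1 - D / 2 * (p - 1)).
Local Notation be := (D / 2 * (p - 1) - 2).
Local Notation kap := (D * (p - 1) / (2 * (p + 1))).
Local Notation theta := ((D * (p - 1) - 4) / (D * (p - 1))).
Hypotheses (D0 : 0 < D) (p1 : 1 < p) (al0 : 0 < al) (be0 : 0 < be).
Implicit Types (f g : H1 R d) (a b s nu : R).

Let p10 : 0 < p - 1. Proof. by rewrite subr_gt0. Qed.
Let pp10 : 0 < p + 1. Proof. by rewrite addr_gt0// (lt_trans _ p1). Qed.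
Let kap0 : 0 < kap. Proof. by rewrite divr_gt0// ?mulr_gt0. Qed.
Let albe : al + be = p - 1. Proof. by lra. Qed.

Lemma H1_norms f : H1_nonzero f -> exists a b,
  [/\ 0 < a, 0 <= b, LnormC 2 f = a%:E & gradnorm f = b%:E].
Proof.
move=> /(LnormC_gt0 f (ltr0n _ 2)) a0.
have [_ afin] := H1_fun_L2 f; have bfin := gradnorm_lty f.
have b0 : (0 <= gradnorm f)%E by exact: Lnorm_ge0.
exists (fine (LnormC 2 f)), (fine (gradnorm f)); split.
- by rewrite fine_gt0// a0.
- exact: fine_ge0.
- by rewrite fineK// ge0_fin_numE// ltW.
- by rewrite fineK// ge0_fin_numE.
Qed.

(** The function s nu^(d/2) f(nu x): this normalisation makes s the factor of
the L2 norm, and then s nu that of the gradient. *)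
Lemma two_parameter_family s nu f : 0 < s -> 0 < nu -> H1_nonzero f ->
  exists g : H1 R d, [/\ H1_nonzero g,
    LnormC 2 g = (s%:E * LnormC 2 f)%E,
    gradnorm g = ((s * nu)%:E * gradnorm f)%E &
    (LnormC (p + 1) g `^ (p + 1) =
      (s `^ (p + 1) * nu `^ (be + 2))%:E * LnormC (p + 1) f `^ (p + 1))%E].
Proof.
move=> s0 nu0 f0; have nuN : nu != 0 by rewrite gt_eqF.
have lam0 : 0 < s * nu `^ (D / 2) by rewrite mulr_gt0// powR_gt0.
have lamE : s * nu `^ (D / 2) * nu `^ (- (D / 2)) = s.
  by rewrite -mulrA -powRD ?nuN ?implybT// subrr powRr0 mulr1.
have g2 : LnormC 2 (H1_rescale lam0 nu0 f) = (s%:E * LnormC 2 f)%E.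
  by rewrite /= LnormC_rescale// lamE.
exists (H1_rescale lam0 nu0 f); split => //.
- apply/(LnormC_gt0 _ (ltr0n _ 2)); rewrite g2 mule_gt0 ?lte_fin//.
  exact/LnormC_gt0.
- by rewrite gradnorm_rescale mulrAC lamE.
- rewrite /LnormC (@LnormR_pow_rescale R d (p + 1) _ _
    (fun x => ComplexField.Normc.normc (f x)) _ pp10 lam0 nu0); last first.
    by move=> x; rewrite /= /rescale normc_scale// ltW.
  congr ((_%:E * _)%E); rewrite powRM ?powR_ge0 ?(ltW s0)// -mulrA; congr (_ * _).
  rewrite -powR_invn ?(ltW nu0)// -powRrM -powRD ?nuN ?implybT//; congr (_ `^ _).
  by field.
Qed.

Lemma calN2E f a b : LnormC 2 f = a%:E -> gradnorm f = b%:E ->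
  calN2 p f = (a `^ al * b `^ be)%:E.
Proof. by move=> fa fb; rewrite /calN2 fa fb. Qed.

Lemma tildeH1_sqrE f a b : LnormC 2 f = a%:E -> gradnorm f = b%:E ->
  tildeH1_sqr p f = (2 * be / (D * (p - 1)) * b ^+ 2 + a ^+ 2)%:E.
Proof.
move=> fa fb; rewrite /tildeH1_sqr fa fb -!EFin_expe -EFinM -EFinD.
by congr (_ * _ + _)%:E; congr (_ / _); field.
Qed.

Lemma calK_le0E f b : gradnorm f = b%:E ->
  (calK p f <= 0)%E = ((b ^+ 2)%:E <= kap%:E * LnormC (p + 1) f `^ (p + 1))%E.
Proof.
move=> fb; rewrite /calK fb -EFin_expe.
have : (0 <= LnormC (p + 1) f `^ (p + 1))%E by exact: poweR_ge0.
case: (_ `^ _)%E => [c| |] //= _.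
  by rewrite -EFinM -EFinB !lee_fin subr_le0.
by rewrite gt0_muley ?lte_fin// leey leNye.
Qed.

Lemma calN2_ge0 f : (0 <= calN2 p f)%E.
Proof. by rewrite mule_ge0// poweR_ge0. Qed.

Lemma family_calN2 s nu f g : 0 < s -> 0 < nu -> H1_nonzero f ->
  LnormC 2 g = (s%:E * LnormC 2 f)%E ->
  gradnorm g = ((s * nu)%:E * gradnorm f)%E ->
  calN2 p g = ((s `^ (p - 1) * nu `^ be)%:E * calN2 p f)%E.
Proof.
move=> s0 nu0 /H1_norms[a [b [a0 b0 fa fb]]]; rewrite fa fb -!EFinM => ga gb.
rewrite (calN2E ga gb) (calN2E fa fb) -EFinM; congr EFin.
rewrite !powRM ?mulr_ge0 ?(ltW s0) ?(ltW nu0) ?(ltW a0)//.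
have -> : s `^ (p - 1) = s `^ al * s `^ be.
  by rewrite -powRD ?(gt_eqF s0) ?implybT// albe.
ring.
Qed.

Lemma family_calK s nu f g b : 0 < s -> 0 < nu ->
  gradnorm f = b%:E -> gradnorm g = ((s * nu)%:E * gradnorm f)%E ->
  (LnormC (p + 1) g `^ (p + 1) =
    (s `^ (p + 1) * nu `^ (be + 2))%:E * LnormC (p + 1) f `^ (p + 1))%E ->
  (calK p g <= 0)%E = ((b ^+ 2)%:E <=
    (s `^ (p - 1) * nu `^ be * kap)%:E * LnormC (p + 1) f `^ (p + 1))%E.
Proof.
move=> s0 nu0 fb gb gc; rewrite fb -EFinM in gb.
have sn0 : 0 < s ^+ 2 * nu ^+ 2 by rewrite mulr_gt0 ?exprn_gt0.
rewrite (calK_le0E gb) gc muleA -EFinM.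
rewrite (_ : (s * nu * b) ^+ 2 = (s ^+ 2 * nu ^+ 2) * b ^+ 2); last by ring.
rewrite (_ : kap * _ = (s ^+ 2 * nu ^+ 2) * (s `^ (p - 1) * nu `^ be * kap)); last first.
  have -> : nu `^ (be + 2) = nu `^ be * nu ^+ 2.
    by rewrite powRD ?(gt_eqF nu0) ?implybT// (powR_mulrn 2 (ltW nu0)).
  have -> : s `^ (p + 1) = s `^ (p - 1) * s ^+ 2.
    rewrite -(powR_mulrn 2 (ltW s0)) -powRD ?(gt_eqF s0) ?implybT//.
    by congr (_ `^ _); ring.
  ring.
by rewrite !EFinM -[X in (_ <= X)%E]muleA lee_pmul2l// lte_fin.
Qed.

(** Every admissible member of the family of f bounds the infimum N_2, and both
its admissibility and its value depend only on s^(p-1) nu^be. *)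
Lemma N2_le_family s nu f b : 0 < s -> 0 < nu -> H1_nonzero f ->
  gradnorm f = b%:E ->
  ((b ^+ 2)%:E <=
    (s `^ (p - 1) * nu `^ be * kap)%:E * LnormC (p + 1) f `^ (p + 1))%E ->
  (N2 d p <= (s `^ (p - 1) * nu `^ be)%:E * calN2 p f)%E.
Proof.
move=> s0 nu0 f0 fb Kf; have [g [g0 ga gb gc]] := two_parameter_family s0 nu0 f0.
rewrite -(family_calN2 s0 nu0 f0 ga gb); apply: ereal_inf_lbound.
by exists g => //; split => //; rewrite (family_calK s0 nu0 fb gb gc).
Qed.

Lemma le0_of_small (x : \bar R) (n : R) :
  (forall t, 0 < t -> (x <= (t * n)%:E)%E) -> (x <= 0)%E.
Proof.
move=> H; apply/lee_addgt0Pr => e e0; rewrite add0e.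
have n0 : 0 < `|n| + 1 by rewrite ltr_wpDl.
apply: (le_trans (H (e / (`|n| + 1)) _)); first by rewrite divr_gt0.
rewrite lee_fin -mulrA ger_pMr// mulrC ler_pdivrMr// mul1r.
by rewrite (le_trans (ler_norm _))// lerDl.
Qed.

Lemma root_powR t : 0 < t -> exists2 s, 0 < s & s `^ (p - 1) = t.
Proof.
move=> t0; exists (t `^ (p - 1)^-1); first exact: powR_gt0.
by rewrite -powRrM mulVf ?gt_eqF// powRr1// ltW.
Qed.

(** In both cases every positive multiple of f satisfies the constraint, and N_2
is homogeneous of positive degree. *)
Lemma N2_le0_degenerate f b : H1_nonzero f -> gradnorm f = b%:E ->
  b = 0 \/ (LnormC (p + 1) f `^ (p + 1) = +oo)%E -> (N2 d p <= 0)%E.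
Proof.
move=> f0 fb bc.
have [a [b' [a0 _ fa _]]] := H1_norms f0.
apply: (@le0_of_small _ (a `^ al * b `^ be)) => t t0.
have [s s0 st] := root_powR t0.
have st1 : s `^ (p - 1) * 1 `^ be = t by rewrite powR1 mulr1.
rewrite EFinM -(calN2E fa fb) -st1.
apply: (@N2_le_family _ _ _ b) => //; rewrite st1.
have tk : 0 < t * kap by exact: mulr_gt0.
case: bc => [->|->]; last by rewrite gt0_muley ?lte_fin// leey.
by rewrite expr0n/= mule_ge0 ?poweR_ge0// lee_fin ltW.
Qed.

Lemma N2_ge0 : (0 <= N2 d p)%E.
Proof. by apply/ereal_infP => _ [f _ <-]; exact: calN2_ge0. Qed.

Lemma powR_gradnorm_split b : 0 <= b -> b `^ (D / 2 * (p - 1)) = b `^ be * b ^+ 2.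
Proof.
move=> b0; rewrite -(powR_mulrn 2 b0) -powRD ?subrK// implybE; apply/orP; left.
by rewrite gt_eqF// mulr_gt0// divr_gt0.
Qed.

(** On the constraint, b^2 <= kap c compares I with N_2; conversely a multiple of
f lies on the boundary of the constraint, and there the comparison is an
equality. *)
Lemma N3E : N3 d p = (kap%:E * N2 d p)%E.
Proof.
apply/eqP; rewrite eq_le; apply/andP; split.
  rewrite -ereal_inf_pZl//; apply/ereal_infP => _ [_ [f [f0 Kf] <-] <-].
  apply: le_trans (_ : calI p f <= _)%E; first by apply: ereal_inf_lbound; exists f.
  have [a [b [a0 b0 fa fb]]] := H1_norms f0.
  have c0 : (0 < LnormC (p + 1) f `^ (p + 1))%E by apply: poweR_gt0; apply/LnormC_gt0.
  rewrite (calN2E fa fb) /calI fa fb.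
  move: Kf c0; rewrite (calK_le0E fb).
  case: (_ `^ _)%E => [c| |] //= Kf c0; last first.
    by rewrite invey mule0 -EFinM lee_fin (mulr_ge0 (ltW kap0))// mulr_ge0// powR_ge0.
  move: Kf c0; rewrite -!EFinM !lee_fin lte_fin => Kf c0.
  rewrite inver gt_eqF// -EFinM lee_fin ler_pdivrMr//.
  rewrite powR_gradnorm_split//.
  rewrite (_ : kap * _ * c = a `^ al * b `^ be * (kap * c)); last by ring.
  by rewrite [leLHS]mulrA ler_wpM2l// mulr_ge0// powR_ge0.
apply/ereal_infP => _ [f f0 <-].
have [a [b [a0 b0 fa fb]]] := H1_norms f0.
have c0 : (0 < LnormC (p + 1) f `^ (p + 1))%E by apply: poweR_gt0; apply/LnormC_gt0.
have I0 : (0 <= calI p f)%E.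
  by rewrite /calI !mule_ge0 ?poweR_ge0// inve_ge0 ltW.
have [/(N2_le0_degenerate f0 fb) h|[b1 cfin]] :
    (b = 0 \/ (LnormC (p + 1) f `^ (p + 1) = +oo)%E)
    \/ (0 < b /\ (LnormC (p + 1) f `^ (p + 1) < +oo)%E).
  have [->|bn] := eqVneq b 0; first by left; left.
  have [->|cn] := eqVneq (LnormC (p + 1) f `^ (p + 1))%E +oo%E; first by left; right.
  by right; rewrite lt_def bn b0 ltey.
- have -> : N2 d p = 0%E by apply/eqP; rewrite eq_le h N2_ge0.
  by rewrite mule0.
- have cE : (LnormC (p + 1) f `^ (p + 1))%E =
      (fine (LnormC (p + 1) f `^ (p + 1))%E)%:E.
    by rewrite fineK// ge0_fin_numE// ltW.
  move: cE c0; set c := fine _ => cE; rewrite cE lte_fin => c0.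
  have kc0 : 0 < kap * c by exact: mulr_gt0.
  (* the factor for which the constraint becomes an equality *)
  have t0 : 0 < b ^+ 2 / (kap * c) by rewrite divr_gt0 ?exprn_gt0.
  have [s s0 st] := root_powR t0.
  have := @N2_le_family s 1 f b s0 ltr01 f0 fb.
  rewrite powR1 mulr1 st cE -EFinM lee_fin.
  rewrite -[_ * kap * c]mulrA divfK ?(gt_eqF kc0)//.
  move=> /(_ (lexx _)) H.
  rewrite muleC -lee_pdivlMr//; apply: le_trans H _.
  rewrite (calN2E fa fb) /calI fa fb cE inver gt_eqF// -!EFinM lee_fin.
  rewrite le_eqVlt; apply/orP; left; apply/eqP.
  rewrite powR_gradnorm_split//.
  rewrite invfM; ring.
Qed.

(** The lower bound on N_1 is the sharp inequality at each admissible f.  For the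
upper bound, f is moved along its family, keeping K <= 0 and N_2 unchanged, to
the point where the sharp inequality is an equality. *)
Lemma N1E : (N1 d p `^ ((p - 1) / 2) = (sharp_const D p al)%:E * N2 d p)%E.
Proof.
have C0 := sharp_const_gt0 D0 p1 al0.
have g0 : 0 < (p - 1) / 2 by rewrite divr_gt0.
have N10 : (0 <= N1 d p)%E.
  apply/ereal_infP => _ [f [/H1_norms[a [b [a0 b0 fa fb]]] _] <-].
  rewrite (tildeH1_sqrE fa fb) lee_fin addr_ge0 ?sqr_ge0// mulr_ge0 ?sqr_ge0//.
  by rewrite divr_ge0 ?mulr_ge0 ?ltW.
apply/eqP; rewrite eq_le; apply/andP; split.
  rewrite -ereal_inf_pZl//; apply/ereal_infP => _ [_ [f [f0 Kf] <-] <-].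
  have [a [b [a0 b0 fa fb]]] := H1_norms f0.
  have [bz|bn] := eqVneq b 0.
    suff -> : N1 d p = 0%E.
      by rewrite poweR0r ?gt_eqF// mule_ge0 ?calN2_ge0// lee_fin ltW.
    apply/eqP; rewrite eq_le N10 andbT.
    apply: (@le0_of_small _ (a ^+ 2)) => t t0.
    (* without gradient term the functional is s^2 a^2 for s f *)
    have s0 : 0 < Num.sqrt t by rewrite sqrtr_gt0.
    have [g [gn ga gb gc]] := two_parameter_family s0 ltr01 f0.
    have Kg : (calK p g <= 0)%E.
      rewrite (family_calK s0 ltr01 fb gb gc) bz expr0n/=.
      by rewrite mule_ge0 ?poweR_ge0// lee_fin (mulr_ge0 _ (ltW kap0))// mulr_ge0// powR_ge0.
    rewrite fa fb bz -!EFinM in ga gb.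
    apply: le_trans (_ : tildeH1_sqr p g <= _)%E.
      by apply: ereal_inf_lbound; exists g.
    by rewrite (tildeH1_sqrE ga gb) mulr0 expr0n/= mulr0 add0r exprMn sqr_sqrtr// ltW.
  have b1 : 0 < b by rewrite lt_def bn.
  pose X := D * (p - 1) / (2 * al).
  have X0 : 0 < X by rewrite divr_gt0 ?mulr_gt0.
  (* the dilation that brings b^2 / a^2 to the value X of the equality case *)
  pose nu := Num.sqrt X * a / b.
  have nu0 : 0 < nu by rewrite divr_gt0// mulr_gt0// sqrtr_gt0.
  have nub0 : 0 < nu `^ (- be) by exact: powR_gt0.
  have [s s0 st] := root_powR nub0.
  have snu : s `^ (p - 1) * nu `^ be = 1.
    by rewrite st -powRD ?(gt_eqF nu0) ?implybT// addNr powRr0.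
  have [g [gn ga gb gc]] := two_parameter_family s0 nu0 f0.
  have Kg : (calK p g <= 0)%E.
    by rewrite (family_calK s0 nu0 fb gb gc) snu mul1r -(calK_le0E fb).
  have := family_calN2 s0 nu0 f0 ga gb; rewrite snu mul1e => <-.
  rewrite fa fb -!EFinM in ga gb.
  have a'0 : 0 < s * a by exact: mulr_gt0.
  have b1g : 0 < s * nu * b by apply: mulr_gt0 => //; exact: mulr_gt0.
  have rel : (s * nu * b) ^+ 2 = X * (s * a) ^+ 2.
    rewrite -mulrA divfK// mulrA !exprMn sqr_sqrtr ?(ltW X0)//; ring.
  rewrite (calN2E ga gb) -EFinM -(sharp_const_eq D0 p1 al0 be0 albe a'0 b1g rel).
  rewrite -poweR_EFin -(tildeH1_sqrE ga gb).
  apply: gt0_ler_poweR; rewrite ?(ltW g0)// ?in_itv/= ?leey ?andbT//.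
    rewrite (tildeH1_sqrE ga gb) lee_fin addr_ge0 ?sqr_ge0// mulr_ge0 ?sqr_ge0//.
    by rewrite divr_ge0 ?mulr_ge0 ?ltW.
  by apply: ereal_inf_lbound; exists g.
have y0 : (0 <= (sharp_const D p al)%:E * N2 d p)%E.
  by rewrite mule_ge0 ?N2_ge0// lee_fin ltW.
set y := (_ * _)%E in y0 *.
suff H : (y `^ ((p - 1) / 2)^-1 <= N1 d p)%E.
  rewrite -[leLHS](_ : (y `^ ((p - 1) / 2)^-1) `^ ((p - 1) / 2) = y)%E; last first.
    by rewrite -poweRrM mulVf ?gt_eqF// poweRe1.
  by apply: gt0_ler_poweR; rewrite ?(ltW g0)// ?in_itv/= ?leey ?andbT// poweR_ge0.
apply/ereal_infP => _ [f [f0 Kf] <-].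
have [a [b [a0 b0 fa fb]]] := H1_norms f0.
have T0 : 0 <= 2 * be / (D * (p - 1)) * b ^+ 2 + a ^+ 2.
  by rewrite addr_ge0 ?sqr_ge0// mulr_ge0 ?sqr_ge0// divr_ge0 ?mulr_ge0 ?ltW.
rewrite (tildeH1_sqrE fa fb).
have : (y <= (2 * be / (D * (p - 1)) * b ^+ 2 + a ^+ 2)%:E `^ ((p - 1) / 2))%E.
  apply: le_trans (_ : (sharp_const D p al)%:E * calN2 p f <= _)%E.
    rewrite lee_pmul2l ?lte_fin//; apply: ereal_inf_lbound; by exists f.
  by rewrite (calN2E fa fb) poweR_EFin -EFinM lee_fin; exact: sharp_const_le.
have gi0 : 0 <= ((p - 1) / 2)^-1 by rewrite invr_ge0 ltW.
move=> /(gt0_ler_poweR gi0); rewrite !in_itv/= !leey !andbT lee_fin => /(_ y0 (powR_ge0 _ _)).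
by rewrite -powRrM mulfV ?gt_eqF// powRr1.
Qed.

End variational.

Theorem proposition1p1 (R : realType) (d : nat) (p : R)
    (hd : (1 <= d)%N) (hp : 2 + 4 / d%:R < p + 1)
    (hp2 : ((p + 1)%:E < two_star R d)%E) :
  (N1 d p `^ ((p - 1) / 2) =
     ((2 / d%:R) `^ ((p - 1) / 2) *
      (d%:R * (p - 1) / ((d%:R + 2) - (d%:R - 2) * p))
        `^ (1 / 4 * ((d%:R + 2) - (d%:R - 2) * p)))%:E * N2 d p)%E /\
  (N3 d p = (d%:R * (p - 1) / (2 * (p + 1)))%:E * N2 d p)%E.
Proof.
have D0 : 0 < d%:R :> R by rewrite ltr0n.
have p4 : 4 / d%:R < p - 1 by lra.
have p1 : 1 < p by rewrite -subr_gt0 (lt_trans _ p4)// divr_gt0.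
have be0 : 0 < d%:R / 2 * (p - 1) - 2.
  by move: p4; rewrite ltr_pdivrMr// => p4; lra.
have alE : (d%:R + 2) - (d%:R - 2) * p = 2 * (p + 1 - d%:R / 2 * (p - 1)) by field.
(* positivity of al is the subcriticality p + 1 < 2^*, automatic if d <= 2 *)
have al0 : 0 < p + 1 - d%:R / 2 * (p - 1).
  move: hp2; rewrite /two_star; case: ifPn => [d2 _|].
    have : d = 1%N \/ d = 2%N.
      by case: d hd d2 {D0 hp p4 be0 alE} => [|[|[|]]]//; [left|right].
    by case=> ->; lra.
  rewrite -ltnNge => d2; have D2 : 0 < d%:R - 2 :> R by rewrite subr_gt0 (ltr_nat R 2).
  rewrite lte_fin ltr_pdivlMr// => h; lra.
rewrite (N1E D0 p1 al0 be0) (N3E D0 p1); split => //.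
rewrite /sharp_const alE; congr (((_ * _ `^ _)%:E * _)%E); by field.
Qed.
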